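(* Fix $\ell_0>0$ and $h_0>0$. There exist $U_0=U_0(\ell_0,d,h_0,t)$ and a function $\varepsilon_{\rm ch}(U,\beta;h_0)\ge0$ such that for all $U\ge U_0$, all $\beta>0$ with $\beta J_0(U)\ge\ell_0$, all $L\in2\mathbb N$ and all $|h|\le h_0$, writing $\omega=\omega^{\rm Hub}_{\Lambda_L,\beta,U,h}$: \[ \frac1{|\Lambda_L|}\sum_{x\in\Lambda_L}\omega(q_x)\le\varepsilon_{\rm ch}(U,\beta;h_0),\qquad \frac1{|\Lambda_L|}\sum_{x\in\Lambda_L}\omega(n_{x\uparrow}n_{x\downarrow})\le\tfrac12\varepsilon_{\rm ch}(U,\beta;h_0), \] \[ \Bigl|\frac1{|\Lambda_L|}\omega(C^{\rm ch}_{\Lambda_L})\Bigr|\le\varepsilon_{\rm ch}(U,\beta;h_0),\qquad \frac1{|\Lambda_L|^2}\omega\bigl((C^{\rm ch}_{\Lambda_L})^2\bigr)\le\varepsilon_{\rm ch}(U,\beta;h_0). \] Finally, $\lim_{U\to\infty}\sup_{\beta J_0(U)\ge\ell_0}\varepsilon_{\rm ch}(U,\beta;h_0)=0$.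
   Context: $d\ge1$, $t\in\mathbb R\setminus\{0\}$; $\Lambda_L=(\mathbb Z/L\mathbb Z)^d$ ($L\in2\mathbb N$), $\mathscr B_{\Lambda_L}$ the unordered nearest-neighbour bonds (each once). Fermionic Fock space over $\ell^2(\Lambda_L)\otimes\mathbb C^2$ with CAR operators $c_{x\sigma}$; $n_{x\sigma}=c^*_{x\sigma}c_{x\sigma}$, $n_x=n_{x\uparrow}+n_{x\downarrow}$; half-filled sector $\mathcal H^{\rm hf}_{\Lambda_L}=\ker(\sum_xn_x-|\Lambda_L|)$. $D_{\Lambda_L}=\sum_xn_{x\uparrow}n_{x\downarrow}$, $T_{\Lambda_L}=-t\sum_{\{x,y\}\in\mathscr B}\sum_\sigma(c^*_{x\sigma}c_{y\sigma}+c^*_{y\sigma}c_{x\sigma})$, $\eta_x=(-1)^{x_1+\dots+x_d}$, $M_{\Lambda_L}=\sum_x\eta_x\frac12(n_{x\uparrow}-n_{x\downarrow})$, $H^{\rm Hub}_{\Lambda_L}(h)=UD_{\Lambda_L}+T_{\Lambda_L}-hM_{\Lambda_L}$ on $\mathcal H^{\rm hf}_{\Lambda_L}$ ($U>0$). $\omega^{\rm Hub}_{\Lambda_L,\beta,U,h}(O)=\operatorname{Tr}_{\mathcal H^{\rm hf}}(Oe^{-\beta H^{\rm Hub}_{\Lambda_L}(h)})/\operatorname{Tr}_{\mathcal H^{\rm hf}}e^{-\beta H^{\rm Hub}_{\Lambda_L}(h)}$. $J_0(U)=4t^2/U$. Charge observables: $q_x=(n_x-1)^2$ and $C^{\rm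 ch}_{\Lambda_L}=\sum_{x\in\Lambda_L}\eta_x(n_x-1)$. *)

(* Defs.v *)
From HB Require Import structures.
From mathcomp Require Import all_boot all_order all_algebra.
From mathcomp Require Import all_classical all_reals all_analysis.
Set Implicit Arguments. Unset Strict Implicit. Unset Printing Implicit Defensive.
Import Order.TTheory GRing.Theory Num.Theory.
Local Open Scope ring_scope.

Section Hubbard.
Variable R : realType.
Variables (L d : nat).

Definition site := {ffun 'I_d -> 'I_L}.
(* modes: site x spin (true = up, false = down) *)
Definition mode := (site * bool)%type.
(* occupation-number configurations: basis of the fermionic Fock space *)
Definition conf := {ffun mode -> bool}.
Definition dimF := #|{: conf}|.
Definition op := 'M[R]_dimF.

Definition nnext (x y : site) : bool :=
  [exists i : 'I_d, (val (y i) == (val (x i)).+1 %% L)%N &&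
                    [forall j : 'I_d, (j != i) ==> (y j == x j)]].
Definition bond (x y : site) : bool := nnext x y || nnext y x.

Definition eta (x : site) : R := (-1) ^+ (\sum_(i < d) val (x i))%N.

(* Jordan-Wigner realisation of the CAR on the Fock space, modes ordered by enum_rank *)
Definition jw_sign (b : conf) (m : mode) : R :=
  (-1) ^+ #|[pred m' : mode | (enum_rank m' < enum_rank m)%N && b m']|.
Definition empty_at (b : conf) (m : mode) : conf :=
  [ffun m' => if m' == m then false else b m'].

(* annihilation operator c_m : matrix entry (a, b) = <a| c_m |b> *)
Definition cop (m : mode) : op :=
  \matrix_(i, j) (let a : conf := enum_val i in let b : conf := enum_val j in
     if b m && (a == empty_at b m) then jw_sign b m else 0).
(* creation operator c_m^* (adjoint = transpose, entries are real) *)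
Definition cdag (m : mode) : op := (cop m)^T.
Definition numop (m : mode) : op := cdag m *m cop m.
Definition nsite (x : site) : op := numop (x, true) + numop (x, false).

Definition Dop : op := \sum_(x : site) (numop (x, true) *m numop (x, false)).
Definition Top (t : R) : op :=
  - t *: \sum_(s : bool) \sum_(x : site) \sum_(y : site | bond x y)
           (cdag (x, s) *m cop (y, s)).
Definition Mop : op :=
  \sum_(x : site) (eta x / 2) *: (numop (x, true) - numop (x, false)).
Definition Hhub (t U h : R) : op := U *: Dop + Top t - h *: Mop.

Definition Nop : op := \sum_(x : site) nsite x.
(* orthogonal projector onto the half-filled sector ker (N - |Lambda|)
   (N is diagonal in the occupation basis) *)
Definition Phf : op :=
  \matrix_(i, j) ((i == j) && (Nop i i == #|{: site}|%:R))%:R.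

Fixpoint mxpow (A : op) (k : nat) : op :=
  if k is k'.+1 then A *m mxpow A k' else 1%:M.
Definition expm (A : op) : op :=
  \matrix_(i, j) limn (fun N : nat => \sum_(k < N) mxpow A k i j / (k`!)%:R).

(* e^{-beta H} on the half-filled sector (extended by 0) *)
Definition gibbs_hf (t U h beta : R) : op :=
  Phf *m expm (- beta *: (Phf *m Hhub t U h *m Phf)) *m Phf.
Definition omega (t U h beta : R) (O : op) : R :=
  \tr (Phf *m O *m Phf *m gibbs_hf t U h beta) / \tr (gibbs_hf t U h beta).

Definition qop (x : site) : op := (nsite x - 1%:M) *m (nsite x - 1%:M).
Definition Cch : op := \sum_(x : site) eta x *: (nsite x - 1%:M).

End Hubbard.

Definition J0 (R : realType) (t U : R) : R := 4 * t ^+ 2 / U.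

(* Main.v *)
(* A Gibbs state nearly minimises the energy: its energy density exceeds that of
   any trial state by at most the entropy density divided by [beta].  The
   diagonal state with one up electron per site has no double occupancy, the
   hopping and staggered terms are bounded by a constant times the volume, and
   [1 / beta] is bounded since [beta * J0 t U >= l0]; hence [U * omega(D) / V]
   is bounded by a constant.  On the half-filled sector the total squared charge
   equals [2 * D], and it dominates the charge observables in the occupation
   basis, where the diagonal of a Gibbs state is a probability vector.

   The exponential of the symmetric matrix [A] is handled through a resolution
   [A *m W l = d l *: W l], [\sum_l W l = 1%:M] by real positive semidefinite
   matrices [W l], namely the real parts of the rank-one spectral projections
   over [R[i]]. *)
Require Import Defs.
From HB Require Import structures.
From mathcomp Require Import all_boot all_order all_algebra.
From mathcomp Require Import complex ring lra.
From mathcomp Require Import all_classical all_reals all_analysis.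
Import Order.TTheory GRing.Theory Num.Theory.
Import numFieldNormedType.Exports.
Local Open Scope ring_scope.
Set Implicit Arguments. Unset Strict Implicit. Unset Printing Implicit Defensive.

(** * Spectral resolution of a real symmetric matrix *)

Lemma symmetric_spectral_resolution (R : rcfType) n (A : 'M[R]_n) : A^T = A ->
  exists (d : 'I_n -> R) (W : 'I_n -> 'M[R]_n),
    [/\ forall l, A *m W l = d l *: W l,
        \sum_l W l = 1%:M,
        forall l i, 0 <= W l i i
      & forall l i j, `|W l i j| <= (W l i i + W l j j) / 2].
Proof.
move=> symA.
pose AC := map_mx (real_complex R) A.
have hA : AC \is hermsymmx.
  apply: realsym_hermsym.
    by apply/is_hermitianmxP; rewrite expr0 scale1r map_mx_id // /AC map_trmx symA.
  by apply/mxOverP => i j; rewrite mxE; apply/complex_realP; exists (A i j).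
have Ad := hermitian_spectral_diag_real hA.
have /orthomx_spectralP AE := hermitian_normalmx hA.
have unitU := spectral_unitarymx AC.
set U := spectralmx AC in AE unitU.
set D := spectral_diag AC in AE Ad.
exists (fun l => complex.Re (D 0 l)).
(* The rows of the unitary [U] are the conjugated eigenvectors. Passing to real parts keeps the
   eigenvalue equation because [A] and the eigenvalues are real. *)
exists (fun l => \matrix_(i, j) complex.Re (conjc (U l i) * U l j)).
have ReD (I : finType) (F : I -> R[i]) :
  complex.Re (\sum_i F i) = \sum_i complex.Re (F i).
  by elim/big_rec2: _ => // i x y _ <-; case: (F i) y => [a b] [u v].
have ReZ a (z : R[i]) : complex.Re (a%:C%C * z) = a * complex.Re z.
  by case: z => u v /=; rewrite mul0r subr0.
split.
- move=> l; apply/matrixP => i j; rewrite !mxE.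
  have eqA : AC *m (U ^t*)%sesqui = (U ^t*)%sesqui *m diag_mx D.
    by rewrite {1}AE invmx_unitary // mulmxtVK.
  have Dl : D 0 l = (complex.Re (D 0 l))%:C%C.
    by rewrite RRe_real //; apply: (mxOverP Ad).
  move/matrixP/(_ i l): eqA; rewrite mul_mx_diag !mxE Dl => eqA.
  under eq_bigr => k _ do rewrite mxE -ReZ mulrA.
  rewrite -ReD -mulr_suml -ReZ mulrA [_ * conjc _]mulrC -[conjc _ * _%:C%C]eqA.
  by under [in RHS]eq_bigr => k _ do rewrite !mxE.
- apply/matrixP => i j; rewrite summxE !mxE.
  under eq_bigr => k _ do rewrite mxE.
  rewrite -ReD.
  have /matrixP/(_ i j) : (U ^t*)%sesqui *m U = 1%:M.
    by rewrite -invmx_unitary // mulVmx // spectral_unit.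
  rewrite !mxE => e.
  transitivity (complex.Re ((i == j)%:R : R[i])); last by case: (i == j).
  by rewrite -e; congr complex.Re; apply: eq_bigr => k _; rewrite !mxE.
- move=> l i; rewrite mxE; case: (U l i) => a b /=.
  by rewrite mulNr opprK -!expr2 addr_ge0 ?sqr_ge0.
(* With [z = U l i] and [w = U l j], both bounds come from expanding [|z + w|^2 >= 0] and
   [|z - w|^2 >= 0]. *)
- move=> l i j; rewrite !mxE; case: (U l i) => a b; case: (U l j) => u v /=.
  rewrite ler_norml; apply/andP; split.
    have := sqr_ge0 (a + u); have := sqr_ge0 (b + v); rewrite !sqrrD !expr2; lra.
  have := sqr_ge0 (a - u); have := sqr_ge0 (b - v); rewrite !sqrrB !expr2; lra.
Qed.

(** * Exponentials of symmetric matrices *)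

(** The tangent to the exponential at the mean [c] lies below the graph, and its linear term
    averages to zero. *)
Lemma jensen_expR (R : realType) (I : finType) (w d : I -> R) :
  (forall l, 0 <= w l) -> \sum_l w l = 1 ->
  expR (\sum_l w l * d l) <= \sum_l w l * expR (d l).
Proof.
move=> w0 w1; set c := \sum_l w l * d l.
have -> : expR c = \sum_l w l * (expR c * (1 + (d l - c))).
  transitivity (\sum_l (expR c * (1 - c) * w l + expR c * (w l * d l))).
    by rewrite big_split -!mulr_sumr /= w1 -/c; ring.
  by apply: eq_bigr => l _; ring.
apply: ler_sum => l _; apply: ler_wpM2l => //.
rewrite -{2}(subrKC c (d l)) expRD.
by apply: ler_wpM2l; [exact: expR_ge0|exact: expR_ge1Dx].
Qed.

(* For [c = ln Z] this is the bound [s] on the entropy of the weights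
   [p l * expR (d l) / Z]. *)
Lemma entropy_bound (R : realType) (I : finType) (p d : I -> R) (c s : R) :
  (forall l, 0 <= p l) -> \sum_l p l <= expR s ->
  expR c <= \sum_l p l * expR (d l) ->
  (c - s) * (\sum_l p l * expR (d l)) <= \sum_l d l * expR (d l) * p l.
Proof.
move=> p0 ps cZ; set Z := \sum_l _ in cZ *.
(* By [1 + x <= expR x], each term is at most [p l * expR (c - s)]; the total is then at most
   [expR s * expR (c - s) = expR c]. *)
have : \sum_l p l * expR (d l) * (1 + (c - s - d l)) <= Z.
  apply: (@le_trans _ _ (\sum_l p l * expR (c - s))).
    apply: ler_sum => l _; rewrite -mulrA; apply: ler_wpM2l => //.
    rewrite -{2}[c - s](subrKC (d l)) expRD.
    by apply: ler_wpM2l; [exact: expR_ge0|exact: expR_ge1Dx].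
  rewrite -mulr_suml (le_trans _ cZ) // (@le_trans _ _ (expR s * expR (c - s))) //.
    by rewrite ler_wpM2r // expR_ge0.
  by rewrite -expRD subrKC.
rewrite (_ : \sum_l _ = (1 + (c - s)) * Z - \sum_l d l * expR (d l) * p l).
  lra.
by rewrite mulr_sumr -sumrB; apply: eq_bigr => l _; ring.
Qed.

Section MatrixExponential.
Variables (R : realType) (L d : nat).
Local Notation op := (op R L d).
Variables (A : op) (e : 'I_(dimF L d) -> R) (W : 'I_(dimF L d) -> op).
Hypothesis eigW : forall l, A *m W l = e l *: W l.
Hypothesis sumW : \sum_l W l = 1%:M.

Lemma mxpow_resolution k : mxpow A k = \sum_l e l ^+ k *: W l.
Proof.
elim: k => [|k IHk] /=.
  by under eq_bigr => l _ do rewrite expr0 scale1r; rewrite sumW.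
rewrite IHk mulmx_sumr; apply: eq_bigr => l _.
by rewrite -scalemxAr eigW scalerA exprSr.
Qed.

Lemma expm_resolution : expm A = \sum_l expR (e l) *: W l.
Proof.
apply/matrixP => i j; rewrite mxE summxE.
under [RHS]eq_bigr => l _ do rewrite mxE.
(* Once the powers of [A] are resolved, each entry is a finite combination of scalar exponential
   series, and the limit passes through the finite sum. *)
rewrite (_ : (fun N => _) =
    (fun N => \sum_l series (exp_coeff (e l)) N * W l i j)).
  apply/cvg_lim => //; apply: cvg_big => [|l _]; first exact: add_continuous.
  by apply: cvgM; [exact: is_cvg_series_exp_coeff|exact: cvg_cst].
apply/funext => N; under [RHS]eq_bigr => l _ do rewrite /series /= big_mkord mulr_suml.
rewrite exchange_big; apply: eq_bigr => k _ /=.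
rewrite mxpow_resolution summxE mulr_suml; apply: eq_bigr => l _.
by rewrite mxE /exp_coeff /= mulrAC.
Qed.

End MatrixExponential.

(** * Operators in the occupation basis *)

Lemma sum_pred1 (R : pzSemiRingType) (I : finType) (i : I) :
  \sum_j (j == i)%:R = 1 :> R.
Proof. by rewrite (bigD1 i) //= eqxx big1 ?addr0 // => j /negPf ->. Qed.

Section FockOperators.
Variables (R : realType) (L d : nat).
Local Notation op := (op R L d).
Local Notation site := (site L d).
Local Notation mode := (mode L d).
Local Notation conf := (conf L d).
Local Notation cop := (@cop R L d).
Local Notation cdag := (@cdag R L d).
Local Notation numop := (@numop R L d).

Definition diag_op (f : conf -> R) : op := diag_mx (\row_i f (enum_val i)).

Lemma diag_opE f i j : diag_op f i j = f (enum_val i) *+ (i == j).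
Proof. by rewrite !mxE. Qed.

Lemma diag_opD f g : diag_op f + diag_op g = diag_op (fun b => f b + g b).
Proof. by apply/matrixP => i j; rewrite mxE !diag_opE mulrnDl. Qed.

Lemma diag_opB f g : diag_op f - diag_op g = diag_op (fun b => f b - g b).
Proof. by apply/matrixP => i j; rewrite !mxE mulrnBl. Qed.

Lemma diag_opZ a f : a *: diag_op f = diag_op (fun b => a * f b).
Proof. by apply/matrixP => i j; rewrite mxE !diag_opE mulrnAr. Qed.

Lemma diag_op1 : 1%:M = diag_op (fun=> 1).
Proof. by apply/matrixP => i j; rewrite mxE diag_opE. Qed.

Lemma diag_opM f g : diag_op f *m diag_op g = diag_op (fun b => f b * g b).
Proof. by apply/matrixP => i j; rewrite mul_diag_mx !mxE mulrnAr. Qed.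

Lemma diag_op_sum (I : finType) (f : I -> conf -> R) :
  \sum_x diag_op (f x) = diag_op (fun b => \sum_x f x b).
Proof.
apply/matrixP => i j; rewrite summxE diag_opE -sumrMnl.
by apply: eq_bigr => x _; rewrite diag_opE.
Qed.

Lemma tr_diag_op f : (diag_op f)^T = diag_op f.
Proof. exact: tr_diag_mx. Qed.

Lemma jw_sign_norm (b : conf) m : `|jw_sign R b m| = 1.
Proof. by rewrite normrX normrN1 expr1n. Qed.

Lemma cop_col m i j : `|cop m i j| <= (i == enum_rank (empty_at (enum_val j) m))%:R.
Proof.
rewrite mxE /=; case: ifP => [/andP[_ /eqP <-]|]; last by rewrite normr0.
by rewrite jw_sign_norm enum_valK eqxx.
Qed.

(** The mode [m] is filled in the source of any nonzero entry, so the source is recovered from the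
    target by filling [m]. *)
Lemma cop_row m i j : `|cop m i j| <=
  (j == enum_rank [ffun m' => (m' == m) || (enum_val i : conf) m'])%:R.
Proof.
rewrite mxE /=; case: ifP => [/andP[bm /eqP ->]|]; last by rewrite normr0.
rewrite jw_sign_norm (_ : [ffun _ => _] = (enum_val j : conf)) ?enum_valK ?eqxx //.
by apply/ffunP => m'; rewrite !ffunE; case: eqP => // ->; rewrite bm.
Qed.

(** Up to signs both factors are partial permutation matrices: [cop_col] leaves one intermediate
    configuration, and [cop_row] then leaves one [j]. *)
Lemma hopping_row x y i : \sum_j `|(cdag x *m cop y) i j| <= 1.
Proof.
apply: (@le_trans _ _ (\sum_j \sum_k `|cop x k i| * `|cop y k j|)).
  apply: ler_sum => j _; rewrite mxE (le_trans (ler_norm_sum _ _ _)) //.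
  by apply: ler_sum => k _; rewrite mxE normrM.
rewrite exchange_big /= -[leRHS](sum_pred1 R (enum_rank (empty_at (enum_val i) x))).
apply: ler_sum => k _; rewrite -mulr_sumr.
apply: le_trans (cop_col x k i); rewrite ler_piMr //.
rewrite -[leRHS](sum_pred1 R (enum_rank
  [ffun m' => (m' == y) || (enum_val k : conf) m'])).
by apply: ler_sum => j _; exact: cop_row.
Qed.

Lemma numopE m : numop m = diag_op (fun b => (b m)%:R).
Proof.
apply/matrixP => i j; rewrite diag_opE mxE.
rewrite (bigD1 (enum_rank (empty_at (enum_val i) m))) //= big1 => [|k /negPf nk].
  rewrite addr0 !mxE /= enum_rankK eqxx andbT; case: ifP => bi; last first.
    by rewrite mul0r mul0rn.
  case: (eqVneq i j) => [<-|ij].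
    by rewrite bi eqxx /= -expr2 -real_normK ?num_real // jw_sign_norm expr1n.
  (* Two configurations that both contain [m] and agree after emptying it are equal, so off-diagonal
     entries vanish. *)
  case: ifP => [/andP[bj /eqP eij]|]; last by rewrite mulr0.
  case/eqP: ij; apply: enum_val_inj; apply/ffunP => m'.
  move/ffunP/(_ m'): eij; rewrite !ffunE; case: eqP => // ->.
  by rewrite bi bj.
have := cop_col m k i; rewrite nk normr_le0 => /eqP ck.
by rewrite [cdag m i k]mxE ck mul0r.
Qed.

Definition occ (b : conf) (x : site) : R := (b (x, true))%:R + (b (x, false))%:R.
Definition dbl (b : conf) (x : site) : R := (b (x, true))%:R * (b (x, false))%:R.

Lemma nsiteE x : nsite R x = diag_op (occ^~ x).
Proof. by rewrite /nsite !numopE diag_opD. Qed.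

Lemma dblE x : numop (x, true) *m numop (x, false) = diag_op (dbl^~ x).
Proof. by rewrite !numopE diag_opM. Qed.

Lemma qopE x : qop R x = diag_op (fun b => (occ b x - 1) ^+ 2).
Proof. by rewrite /qop nsiteE diag_op1 diag_opB diag_opM. Qed.

Lemma DopE : Dop R L d = diag_op (fun b => \sum_x dbl b x).
Proof. by rewrite -diag_op_sum; apply: eq_bigr => x _; rewrite dblE. Qed.

Lemma NopE : Nop R L d = diag_op (fun b => \sum_x occ b x).
Proof. by rewrite -diag_op_sum; apply: eq_bigr => x _; rewrite nsiteE. Qed.

Lemma CchE : Cch R L d = diag_op (fun b => \sum_x Defs.eta R x * (occ b x - 1)).
Proof.
rewrite -diag_op_sum; apply: eq_bigr => x _.
by rewrite nsiteE diag_op1 diag_opB diag_opZ.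
Qed.

Lemma MopE : Mop R L d =
  diag_op (fun b => \sum_x Defs.eta R x / 2 * ((b (x, true))%:R - (b (x, false))%:R)).
Proof.
rewrite -diag_op_sum; apply: eq_bigr => x _.
by rewrite !numopE diag_opB diag_opZ.
Qed.

Lemma eta_norm (x : site) : `|Defs.eta R x| = 1.
Proof. by rewrite normrX normrN1 expr1n. Qed.

(** The sum runs over ordered pairs, so transposition only exchanges the roles of [x] and [y] in a
    symmetric relation. *)
Lemma tr_Top (t : R) : (Top L d t)^T = Top L d t.
Proof.
rewrite /Top linearZ /= linear_sum /=; congr (_ *: _); apply: eq_bigr => s _.
rewrite linear_sum /=; under eq_bigr => x _ do rewrite linear_sum /= big_mkcond.
rewrite exchange_big /=; apply: eq_bigr => x _; rewrite [RHS]big_mkcond.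
apply: eq_bigr => y _; rewrite /bond orbC; case: ifP => // _.
by rewrite trmx_mul trmxK.
Qed.

Lemma tr_Hhub (t U h : R) : (Hhub L d t U h)^T = Hhub L d t U h.
Proof.
by rewrite /Hhub DopE MopE linearB linearD /= tr_Top !diag_opZ !tr_diag_op.
Qed.

(** Each direction [i] determines at most one forward neighbour, and there are [d] directions. *)
Lemma card_nnext (x : site) : (\sum_(y | nnext x y) 1 <= d)%N.
Proof.
pose next i (y : site) := (val (y i) == (val (x i)).+1 %% L)%N &&
  [forall j : 'I_d, (j != i) ==> (y j == x j)].
have next1 i : (\sum_(y | next i y) 1 <= 1)%N.
  rewrite sum1_card; apply/card_le1_eqP => y z /andP[/eqP yi /forallP yj].
  move=> /andP[/eqP zi /forallP zj]; apply/ffunP => j.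
  case: (eqVneq j i) => [->|ji]; first by apply: val_inj; rewrite yi zi.
  by rewrite (eqP (implyP (yj j) ji)) (eqP (implyP (zj j) ji)).
apply: (@leq_trans (\sum_i \sum_(y | next i y) 1)); last first.
  by rewrite -[leqRHS]card_ord -sum1_card leq_sum.
under [leqRHS]eq_bigr => i _ do rewrite big_mkcond.
rewrite exchange_big big_mkcond /=; apply: leq_sum => y _.
by case: ifP => // /existsP[i yi]; rewrite (bigD1 i) //= /next yi.
Qed.

(** A bond is a forward step from [x] or from [y]; exchanging the sums gives both kinds the same
    count. *)
Lemma card_bond : (\sum_(x : site) \sum_(y | bond x y) 1 <= 2 * d * #|{: site}|)%N.
Proof.
have le1 : (\sum_(x : site) \sum_(y | nnext x y) 1 <= d * #|{: site}|)%N.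
  by rewrite mulnC -sum_nat_const; apply: leq_sum => x _; exact: card_nnext.
rewrite -mulnA mul2n -addnn; apply: leq_trans (leq_add le1 le1).
rewrite [X in (_ <= _ + X)%N](eq_bigr (fun x => \sum_y if nnext x y then 1 else 0)%N).
  rewrite exchange_big -big_split; apply: leq_sum => x _ /=.
  rewrite [X in (_ <= X + _)%N]big_mkcond -big_split big_mkcond; apply: leq_sum => y _ /=.
  by rewrite /bond; case: (nnext x y); case: (nnext y x).
by move=> x _; rewrite big_mkcond.
Qed.

Lemma row_norm_sum (I : finType) (P : pred I) (F : I -> op) i :
  \sum_j `|(\sum_(k | P k) F k) i j| <= \sum_(k | P k) \sum_j `|F k i j|.
Proof.
rewrite exchange_big; apply: ler_sum => j _ /=.
by rewrite summxE ler_norm_sum.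
Qed.

(** The factor [4 * d] is two spins times the [2 * d] ordered bonds per site; every hopping term has
    row sum at most one. *)
Lemma Top_row (t : R) i : \sum_j `|Top L d t i j| <= 4 * d%:R * `|t| * #|{: site}|%:R.
Proof.
under eq_bigr => j _ do rewrite mxE normrM normrN.
rewrite -mulr_sumr -[_ * d%:R * _]mulrAC -!mulrA mulrCA ler_wpM2l //.
apply: le_trans (row_norm_sum _ _ _) _.
apply: (@le_trans _ _ (\sum_(s : bool) (2 * d * #|{: site}|)%:R)).
  apply: ler_sum => s _; apply: le_trans (row_norm_sum _ _ _) _.
  apply: le_trans _ (_ : (\sum_(x : site) \sum_(y | bond x y) 1)%:R <= _); last first.
    by rewrite ler_nat card_bond.
  rewrite natr_sum; apply: ler_sum => x _; rewrite natr_sum.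
  apply: le_trans (row_norm_sum _ _ _) _.
  by apply: ler_sum => y _; exact: hopping_row.
rewrite sumr_const card_bool -mulr_natr !natrM; lra.
Qed.

End FockOperators.

(** * The Gibbs state *)

Section GibbsState.
Variables (R : realType) (L d : nat) (t U h beta : R).
Local Notation op := (op R L d).
Local Notation conf := (conf L d).
Local Notation site := (site L d).
Local Notation V := (#|{: site}|%:R : R).
Local Notation P := (Phf R L d).
Local Notation H := (Hhub L d t U h).
Local Notation A := (- beta *: (P *m H *m P)).
Local Notation G := (expm A).
Local Notation om := (@omega R L d t U h beta).

Definition half_filled (b : conf) : bool := \sum_x occ R b x == V.
Local Notation hf i := (half_filled (enum_val i)).

Lemma PhfE : P = diag_op (fun b => (half_filled b)%:R).
Proof.
apply/matrixP => i j; rewrite mxE diag_opE NopE diag_opE eqxx mulr1n.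
by case: eqP => _ /=; rewrite ?mulr1n.
Qed.

Lemma Phf_idem : P *m P = P.
Proof.
rewrite PhfE diag_opM; congr diag_op; apply/funext => b.
by rewrite -natrM mulnb andbb.
Qed.

Lemma compressE (O : op) i j : (P *m O *m P) i j = O i j *+ (hf i && hf j).
Proof.
rewrite PhfE mul_mx_diag mxE mul_diag_mx !mxE mulrC mulrA -natrM mulnb mulr_natl.
by rewrite andbC.
Qed.

Lemma gibbs_spectrum : exists (e : 'I_(dimF L d) -> R) (W : 'I_(dimF L d) -> op),
  [/\ forall l, A *m W l = e l *: W l,
      \sum_l W l = 1%:M,
      forall l i, 0 <= W l i i,
      forall l i j, `|W l i j| <= (W l i i + W l j j) / 2
    & G = \sum_l expR (e l) *: W l].
Proof.
have [|e [W [eigW sumW W0 WW]]] := @symmetric_spectral_resolution R _ A.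
  by rewrite linearZ /= !trmx_mul tr_Hhub mulmxA PhfE tr_diag_op.
by exists e, W; split=> //; exact: expm_resolution.
Qed.

(** Peierls' inequality: the numbers [W l i i] are probability weights on the spectrum with mean
    [A i i], so Jensen applies. *)
Lemma gibbs_diag_ge i : expR (A i i) <= G i i.
Proof.
have [e [W [eigW sumW W0 _ ->]]] := gibbs_spectrum.
have -> : A i i = \sum_l W l i i * e l.
  rewrite -[A]mulmx1 -sumW mulmx_sumr summxE.
  by apply: eq_bigr => l _; rewrite eigW mxE mulrC.
rewrite summxE; under [leRHS]eq_bigr => l _ do rewrite mxE mulrC.
apply: jensen_expR => //; move/matrixP/(_ i i): sumW.
by rewrite summxE mxE eqxx.
Qed.

Lemma gibbs_diag_ge0 i : 0 <= G i i.
Proof. exact: le_trans (expR_ge0 _) (gibbs_diag_ge i). Qed.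

(** Inherited from the matrices [W l], which enter [G] with positive coefficients. *)
Lemma gibbs_offdiag i j : `|G i j| <= (G i i + G j j) / 2.
Proof.
have [e [W [_ _ _ WW ->]]] := gibbs_spectrum.
rewrite !summxE -big_split mulr_suml (le_trans (ler_norm_sum _ _ _)) //.
apply: ler_sum => l _; rewrite !mxE /= -mulrDr -mulrA normrM ger0_norm ?expR_ge0 //.
by rewrite ler_wpM2l ?expR_ge0.
Qed.

(** The restriction to half filling matters: [A] vanishes off the sector, where its exponential is
    the identity rather than zero. *)
Definition partition : R := \sum_(i | hf i) G i i.

Lemma omegaE (O : op) :
  om O = (\sum_(i | hf i) \sum_(j | hf j) O i j * G j i) / partition.
Proof.
rewrite /omega /gibbs_hf; congr (_ / _).
  (* Cyclicity of the trace and idempotence reduce the product to [P *m O *m P *m G]. *)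
  rewrite !mulmxA mxtrace_mulC !mulmxA Phf_idem -[_ *m P *m P]mulmxA Phf_idem.
  rewrite /mxtrace [RHS]big_mkcond /=; apply: eq_bigr => i _.
  rewrite mxE; case: ifP => hi.
    rewrite [RHS]big_mkcond; apply: eq_bigr => j _.
    rewrite compressE hi /=; case: ifP => _; rewrite ?mul0r //.
  by rewrite big1 // => j _; rewrite compressE hi mul0r.
rewrite /mxtrace /partition [RHS]big_mkcond; apply: eq_bigr => i _ /=.
by rewrite compressE andbb; case: ifP.
Qed.

Lemma omegaD O1 O2 : om (O1 + O2) = om O1 + om O2.
Proof.
rewrite !omegaE -mulrDl -big_split; congr (_ / _); apply: eq_bigr => i _ /=.
by rewrite -big_split; apply: eq_bigr => j _ /=; rewrite mxE mulrDl.
Qed.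

Lemma omegaZ a O : om (a *: O) = a * om O.
Proof.
rewrite !omegaE mulrA mulr_sumr; congr (_ / _); apply: eq_bigr => i _.
by rewrite mulr_sumr; apply: eq_bigr => j _; rewrite mxE mulrA.
Qed.

Lemma omegaB O1 O2 : om (O1 - O2) = om O1 - om O2.
Proof. by rewrite omegaD -scaleN1r omegaZ mulN1r. Qed.

Lemma omega_sum (I : finType) (F : I -> op) : om (\sum_x F x) = \sum_x om (F x).
Proof.
elim/big_rec2: _ => [|x y O _ <-]; last by rewrite omegaD.
by rewrite -[0](scale0r 1%:M) omegaZ mul0r.
Qed.

Lemma omega_diag f :
  om (diag_op f) = (\sum_(i | hf i) f (enum_val i) * G i i) / partition.
Proof.
rewrite omegaE; congr (_ / _); apply: eq_bigr => i hi.
rewrite (bigD1 i) //= big1 ?addr0 => [|j /andP[_ /negPf ji]].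
  by rewrite diag_opE eqxx.
by rewrite diag_opE eq_sym ji mul0r.
Qed.

Lemma omega_le f g : (forall b, half_filled b -> f b <= g b) ->
  om (diag_op f) <= om (diag_op g).
Proof.
move=> fg; rewrite !omega_diag ler_wpM2r //.
  by rewrite invr_ge0 sumr_ge0 // => i _; exact: gibbs_diag_ge0.
by apply: ler_sum => i hi; rewrite ler_wpM2r ?gibbs_diag_ge0 // fg.
Qed.

(** * Trial state and energy bound *)

Definition up_state : conf := [ffun m => m.2].

Lemma dbl_up x : dbl R up_state x = 0.
Proof. by rewrite /dbl !ffunE mulr0. Qed.

Lemma up_half_filled : half_filled up_state.
Proof.
apply/eqP; rewrite -sum1_card natr_sum; apply: eq_bigr => x _.
by rewrite /occ !ffunE addr0.
Qed.

(** Peierls' inequality at the trial state; the remaining diagonal entries are nonnegative and are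
    dropped. *)
Lemma partition_ge : expR (- beta * H (enum_rank up_state) (enum_rank up_state)) <= partition.
Proof.
set a := enum_rank _; have hfa : hf a by rewrite enum_rankK up_half_filled.
rewrite /partition (bigD1 a) //= -[leLHS]addr0 lerD //.
  by have := gibbs_diag_ge a; rewrite mxE compressE hfa.
by apply: sumr_ge0 => i _; exact: gibbs_diag_ge0.
Qed.

Lemma partition_gt0 : 0 < partition.
Proof. exact: lt_le_trans (expR_gt0 _) partition_ge. Qed.

Lemma omega_cst c : om (diag_op (fun=> c)) = c.
Proof. by rewrite omega_diag -mulr_sumr mulfK // gt_eqF // partition_gt0. Qed.

Lemma omega_diag_norm f r : (forall b, half_filled b -> `|f b| <= r) ->
  `|om (diag_op f)| <= r.
Proof.
move=> fr; rewrite ler_norml -{1}(omega_cst (- r)) -{2}(omega_cst r).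
by apply/andP; split; apply: omega_le => b /fr; rewrite ler_norml => /andP[].
Qed.

(* Schur's test, read off the positivity of [G] through [gibbs_offdiag]. *)
Lemma omega_norm O r : O^T = O -> (forall i, \sum_j `|O i j| <= r) -> `|om O| <= r.
Proof.
move=> symO Or; have Z0 := partition_gt0.
rewrite omegaE normrM normfV (gtr0_norm Z0) ler_pdivrMr //.
have half : \sum_(i | hf i) \sum_(j | hf j) `|O i j| * G i i <= r * partition.
  rewrite /partition mulr_sumr; apply: ler_sum => i _.
  rewrite -mulr_suml ler_wpM2r ?gibbs_diag_ge0 // (le_trans _ (Or i)) //.
  by rewrite big_mkcond; apply: ler_sum => j _; case: ifP.
(* Exchanging the sums and using the symmetry of [O] reduces this to [half]. *)
have half' : \sum_(i | hf i) \sum_(j | hf j) `|O i j| * G j j <= r * partition.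
  rewrite exchange_big; apply: le_trans half; apply: ler_sum => i _.
  by apply: ler_sum => j _; rewrite -[in leLHS]symO mxE.
apply: (@le_trans _ _ (\sum_(i | hf i) \sum_(j | hf j)
    (`|O i j| * G i i + `|O i j| * G j j) / 2)).
  apply: le_trans (ler_norm_sum _ _ _) _; apply: ler_sum => i _.
  apply: le_trans (ler_norm_sum _ _ _) _; apply: ler_sum => j _.
  by rewrite normrM -mulrDr -mulrA ler_wpM2l // addrC gibbs_offdiag.
under eq_bigr => i _ do rewrite -mulr_suml big_split /=.
by rewrite -mulr_suml big_split /= ler_pdivrMr // mulr_natr mulr2n lerD.
Qed.

Lemma dim_fock : dimF L d = (2 ^ (2 * #|{: site}|))%N.
Proof. by rewrite /dimF card_ffun card_bool card_prod card_bool mulnC. Qed.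

(** The base satisfies [2 <= expR 1]; the entropy per site is thus bounded by [2]. *)
Lemma dim_fock_le : (dimF L d)%:R <= expR (2 * V).
Proof.
rewrite dim_fock natrX -natrM -[X in expR X]mulr1 expRM_natl.
by rewrite lerXn2r ?nnegrE ?expR_ge0 //; have := expR_ge1Dx (1 : R); lra.
Qed.

Lemma omega_energy : 0 < beta ->
  om H <= H (enum_rank up_state) (enum_rank up_state) + 2 * V / beta.
Proof.
move=> beta0; have Zge := partition_ge; have Z0 := partition_gt0.
set E := H _ _ in Zge *.
have [e [W [eigW sumW W0 _ GE]]] := gibbs_spectrum.
(* The trace of [W l] over the half-filled sector, the multiplicity with which [e l] enters the
   partition function. *)
pose p l := \sum_(i | hf i) W l i i.
have ZE : partition = \sum_l p l * expR (e l).
  under [RHS]eq_bigr => l _ do rewrite mulr_suml.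
  rewrite exchange_big; apply: eq_bigr => i _ /=; rewrite GE summxE.
  by apply: eq_bigr => l _; rewrite mxE mulrC.
have omE : - beta * (om H * partition) = \sum_l e l * expR (e l) * p l.
  transitivity (\sum_(i | hf i) (A *m G) i i).
    rewrite omegaE divfK ?gt_eqF // mulr_sumr; apply: eq_bigr => i hi.
    rewrite mxE mulr_sumr [LHS]big_mkcond; apply: eq_bigr => j _.
    by rewrite [A i j]mxE compressE hi mulrA; case: ifP => _; rewrite ?mulr0 ?mul0r.
  under [RHS]eq_bigr => l _ do rewrite mulr_sumr.
  rewrite exchange_big; apply: eq_bigr => i _ /=; rewrite GE mulmx_sumr summxE.
  by apply: eq_bigr => l _; rewrite -scalemxAr eigW scalerA mxE [e l * _]mulrC.
have p0 l : 0 <= p l by apply: sumr_ge0 => i _.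
have sump : \sum_l p l <= expR (2 * V).
  apply: le_trans dim_fock_le; rewrite exchange_big /= big_mkcond /=.
  have -> : (dimF L d)%:R = \sum_(i < dimF L d) 1 :> R by rewrite sumr_const card_ord.
  apply: ler_sum => i _.
  by rewrite -summxE sumW mxE eqxx; case: ifP.
(* Here [c = - beta * E] comes from the trial state and [s = 2 * V] from the dimension; dividing by
   [partition] gives [- beta * E - 2 * V <= - beta * om H]. *)
have := entropy_bound (d := e) p0 sump; rewrite -ZE => /(_ _ Zge).
rewrite -omE mulrA ler_pM2r // => main.
have cancel : beta * (2 * V / beta) = 2 * V by rewrite mulrC divfK // gt_eqF.
rewrite -(ler_pM2l beta0) mulrDr cancel; lra.
Qed.

End GibbsState.

(** * Double occupancy and charge *)

Section DoubleOccupancy.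
Variables (R : realType) (L d : nat) (t U h beta : R).
Local Notation site := (site L d).
Local Notation V := (#|{: site}|%:R : R).
Local Notation om := (@omega R L d t U h beta).

(** The trial state has no double occupancy. The hopping and field terms are each paid twice, in the
    Gibbs state and in the trial state, which doubles [4 * d * |t|] and [|h| / 2]. *)
Lemma omega_dbl : 0 < beta ->
  U * om (Dop R L d) <= (8 * d%:R * `|t| + `|h| + 2 / beta) * V.
Proof.
move=> beta0; have := omega_energy L d t U h beta0.
set a := enum_rank _.
have T1 : `|om (Top L d t)| <= 4 * d%:R * `|t| * V.
  by apply: omega_norm => [|i]; [exact: tr_Top|exact: Top_row].
have T2 : `|Top L d t a a| <= 4 * d%:R * `|t| * V.
  apply: le_trans (Top_row t a); rewrite (bigD1 a) //= lerDl.
  exact: sumr_ge0.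
pose m (b : conf L d) : R := 
  \sum_x Defs.eta R x / 2 * ((b (x, true))%:R - (b (x, false))%:R).
have mV b : `|m b| <= V / 2.
  apply: le_trans (ler_norm_sum _ _ _) _.
  rewrite -sum1_card natr_sum mulr_suml; apply: ler_sum => x _.
  rewrite !normrM eta_norm mul1r normfV normr_nat mul1r ler_piMr ?invr_ge0 //.
  by case: (b _) (b _) => [] []; rewrite ?subrr ?subr0 ?sub0r ?normrN ?normr1 ?normr0.
have M1 : `|om (Mop R L d)| <= V / 2.
  by rewrite MopE; apply: omega_diag_norm => b _; exact: mV.
have M2 : `|Mop R L d a a| <= V / 2 by rewrite MopE diag_opE eqxx mV.
have D0 : Dop R L d a a = 0.
  by rewrite DopE diag_opE eqxx enum_rankK big1 // => x _; exact: dbl_up.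
have hM x : `|x| <= V / 2 -> - (h * x) <= `|h| * (V / 2) /\ h * x <= `|h| * (V / 2).
  move=> xV; have := ler_wpM2l (normr_ge0 h) xV.
  by rewrite -normrM ler_norml => /andP[]; split; lra.
have [_ hM1] := hM _ M1; have [hM2 _] := hM _ M2.
move: T1 T2; rewrite !ler_norml => /andP[T1 _] /andP[_ T2].
have -> : Hhub L d t U h a a = U * Dop R L d a a + Top L d t a a - h * Mop R L d a a.
  by rewrite /Hhub !mxE.
rewrite D0 /Hhub omegaB omegaD [om (U *: _)]omegaZ [om (h *: _)]omegaZ => main; lra.
Qed.


Lemma charge_identity (b : conf L d) x : (occ R b x - 1) ^+ 2 = 1 - occ R b x + 2 * dbl R b x.
Proof. by rewrite /occ /dbl; case: (b _) (b _) => [] [] /=; ring. Qed.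

Lemma charge_norm (b : conf L d) x : `|occ R b x - 1| = (occ R b x - 1) ^+ 2.
Proof.
by rewrite /occ; case: (b _) (b _) => [] []; rewrite ?addrK ?addr0 ?add0r ?subrr
  ?sub0r ?normrN ?normr1 ?normr0 ?sqrrN ?expr1n ?expr0n.
Qed.

(** At half filling the linear part of [charge_identity] sums to zero: empty sites are as many as
    doubly occupied ones. *)
Lemma charge_half_filled (b : conf L d) : half_filled R b ->
  \sum_x (occ R b x - 1) ^+ 2 = 2 * \sum_x dbl R b x.
Proof.
move=> /eqP hfb; under eq_bigr => x _ do rewrite charge_identity.
rewrite big_split sumrB /= hfb -mulr_sumr sumr_const cardT -cardE.
by rewrite subrr add0r.
Qed.

Lemma staggered_charge_norm (b : conf L d) :
  `|\sum_x Defs.eta R x * (occ R b x - 1)| <= \sum_x (occ R b x - 1) ^+ 2.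
Proof.
apply: le_trans (ler_norm_sum _ _ _) _; apply: ler_sum => x _.
by rewrite normrM eta_norm mul1r charge_norm.
Qed.

Lemma charge_le_volume (b : conf L d) : \sum_x (occ R b x - 1) ^+ 2 <= V.
Proof.
rewrite -sum1_card natr_sum; apply: ler_sum => x _; rewrite /occ.
by case: (b _) (b _) => [] [] /=; lra.
Qed.

Lemma omega_charge : \sum_x om (qop R x) = 2 * om (Dop R L d).
Proof.
rewrite -omega_sum; under eq_bigr => x _ do rewrite qopE.
rewrite diag_op_sum DopE -omegaZ diag_opZ; apply/eqP; rewrite eq_le.
by apply/andP; split; apply: omega_le => b hfb; rewrite charge_half_filled.
Qed.

Lemma omega_staggered_charge : `|om (Cch R L d)| <= 2 * om (Dop R L d).
Proof.
rewrite DopE CchE -omegaZ diag_opZ ler_norml -[- om _]mulN1r -omegaZ diag_opZ.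
by apply/andP; split; apply: omega_le => b hfb;
  have := staggered_charge_norm b; rewrite charge_half_filled // ler_norml;
  case/andP; lra.
Qed.

(** In [|C| * |C|] one factor is bounded by the volume and the other by the total squared charge. *)
Lemma omega_staggered_charge_sq :
  om (Cch R L d *m Cch R L d) <= V * (2 * om (Dop R L d)).
Proof.
rewrite DopE CchE diag_opM -!omegaZ !diag_opZ; apply: omega_le => b hfb.
rewrite -expr2 -real_normK ?num_real // expr2.
have C1 := staggered_charge_norm b.
apply: ler_pM => //; last by rewrite -charge_half_filled.
exact: le_trans C1 (charge_le_volume b).
Qed.

End DoubleOccupancy.

(** * Uniform charge suppression at strong coupling *)

Theorem theorem1p9 (R : realType) (d : nat) (t l0 h0 : R) :
  (0 < d)%N -> t != 0 -> 0 < l0 -> 0 < h0 ->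
  exists (U0 : R) (eps : R -> R -> R),
    [/\ 0 < U0,
        (forall U beta, 0 <= eps U beta),
        (forall (U beta h : R) (L : nat),
           U0 <= U -> 0 < beta -> l0 <= beta * J0 t U ->
           (0 < L)%N -> ~~ odd L -> `|h| <= h0 ->
           let om := @omega R L d t U h beta in
           let V : R := #|{: site L d}|%:R in
           [/\ V^-1 * \sum_(x : site L d) om (@qop R L d x) <= eps U beta,
               V^-1 * \sum_(x : site L d)
                        om (@numop R L d (x, true) *m @numop R L d (x, false)) <= eps U beta / 2,
               `| V^-1 * om (Cch R L d) | <= eps U beta
             & (V ^+ 2)^-1 * om (Cch R L d *m Cch R L d) <= eps U beta])
      & (forall e : R, 0 < e -> exists U1 : R, forall U beta : R,
           U1 <= U -> l0 <= beta * J0 t U -> eps U beta <= e)].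
Proof.
move=> _ _ l00 h00.
(* The constant of [omega_dbl], with [|h| <= h0] and [2 / beta <= 8 * t ^+ 2 / l0]. *)
pose K := 8 * d%:R * `|t| + h0 + 8 * t ^+ 2 / l0.
have K0 : 0 <= K.
  apply: addr_ge0; first by rewrite addr_ge0 ?(ltW h00) // !mulr_ge0.
  by rewrite divr_ge0 ?(ltW l00) // mulr_ge0 ?sqr_ge0.
(* The absolute value keeps the bound nonnegative for every real [U]; at [U = 0] the inverse is zero
   by convention. *)
exists 1, (fun U _ => 2 * K / `|U|); split=> //.
- by move=> U _; rewrite !mulr_ge0 ?invr_ge0.
- move=> U beta h L U1 beta0 betaJ L0 _ hh0 om V.
  have U0 : 0 < U := lt_le_trans ltr01 U1.
  have V0 : 0 < V.
    by rewrite ltr0n card_ffun !card_ord expn_gt0 L0.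
  (* The temperature condition reads [l0 * U <= 4 * t ^+ 2 * beta], and [1 <= U] allows dropping
     [U]. *)
  have beta_inv : 2 / beta <= 8 * t ^+ 2 / l0.
    move: betaJ; rewrite /J0 mulrA ler_pdivlMr // => betaJ.
    have := ler_wpM2l (ltW l00) U1.
    rewrite ler_pdivrMr // mulrAC ler_pdivlMr //; lra.
  have omD : V^-1 * om (Dop R L d) <= K / U.
    rewrite mulrC ler_pdivrMr // mulrAC ler_pdivlMr // mulrC.
    apply: le_trans (omega_dbl L d t U h beta0) _.
    by rewrite ler_wpM2r ?(ltW V0) // /K lerD // lerD2l.
  have twoK : V^-1 * (2 * om (Dop R L d)) <= 2 * K / U.
    by rewrite mulrCA -mulrA ler_wpM2l.
  have iV0 : 0 <= V^-1 by rewrite invr_ge0 ltW.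
  rewrite (gtr0_norm U0); split.
  + by rewrite omega_charge.
  + by rewrite -omega_sum (_ : 2 * K / U / 2 = K / U) //; lra.
  + apply: le_trans twoK; rewrite normrM (ger0_norm iV0) ler_wpM2l //.
    exact: omega_staggered_charge.
  (* One of the two inverse volumes cancels the factor [V] of [omega_staggered_charge_sq]. *)
  + apply: le_trans twoK; rewrite expr2 invfM -mulrA ler_wpM2l //.
    rewrite mulrC ler_pdivrMr // mulrC; exact: omega_staggered_charge_sq.
(* For positive [U], [2 * K / U <= e] amounts to [2 * K / e <= U]; the [1] secures positivity. *)
- move=> e e0; exists (Num.max 1 (2 * K / e)) => U beta.
  rewrite ge_max => /andP[U1 Ue] _.
  have U0 : 0 < U := lt_le_trans ltr01 U1.
  by rewrite (gtr0_norm U0) ler_pdivrMr // [e * U]mulrC -ler_pdivrMr.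
Qed.
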